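(* For every $n,\lambda\in\mathbb{N}$ and each $\mu\in\{0,\dots,\lambda\}$, $$OP_{K_n,\operatorname{Aut}(K_n)}(\lambda,\mu)=\frac{1}{n!}\sum_{m=0}^{n}\binom{n}{m}\,Q_m(\lambda-\mu)\,P_{K_{n-m}}(\lambda,\mu),$$ where $Q_m(x)\in\mathbb{Z}[x]$ is defined by $$Q_m(x)=\sum_{k=0}^{m}\left[{m\atop k}\right]_2 x^k,$$ and $P_{K_{n-m}}(\lambda,\mu)$ is given by the formula $P_{K_r}(\lambda,\mu)=\sum_{k=0}^{r}\binom{r}{k}(\lambda-\mu)^k\mu^{\underline{r-k}}$ with $r=n-m$.
   Context: $\mathbb{N}$ denotes the positive integers. $K_n$ is the complete graph on $n$ vertices ($K_0$ is the empty graph), and $\operatorname{Aut}(\Gamma)$ is the automorphism group of a graph $\Gamma$, viewed as a group of permutations of the vertices. A $\lambda$-coloring of $\Gamma$ is a map $f$ from the vertex set of $\Gamma$ to $\{1,\dots,\lambda\}$; it is $\mu$-proper if for every pair of adjacent vertices $v,w$, either $f(v)\ne f(w)$ or $f(v)=f(w)>\mu$. $P_\Gamma(\lambda,\mu)$ is the number of $\mu$-proper $\lambda$-colorings of $\Gamma$. For a subgroup $G$ of $\operatorname{Aut}(\Gamma)$, $OP_{\Gamma,G}(\lambda,\mu)$ is the number of equivalence classes of $\mu$-proper $\lambda$-colorings of $\Gamma$, where $f$ and $f'$ are equivalent if $f'=f\circ g$ for some $g\in G$. $\left[{m\atop k}\right]_2$ denotes the 2-associated Stirling number of the first kind: the number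 of permutations of $m$ elements that decompose into exactly $k$ disjoint cycles, each of length at least $2$ (so $\left[{0\atop 0}\right]_2=1$). $x^{\underline{k}}=x(x-1)\cdots(x-k+1)$ is the falling factorial ($x^{\underline{0}}=1$), and $0^0=1$. *)

(* Defs.v *)
From HB Require Import structures.
From mathcomp Require Import all_boot all_order all_fingroup all_algebra.
Set Implicit Arguments.
Unset Strict Implicit.
Unset Printing Implicit Defensive.
Import GRing.Theory.

Record sgraph (T : finType) := SGraph {
  edge : rel T;
  edge_sym : symmetric edge;
  edge_irrefl : irreflexive edge
}.

Section Graphs.
Variables (T : finType) (E : sgraph T).

Definition graph_aut : {set {perm T}} :=
  [set g : {perm T} | [forall x, forall y, edge E (g x) (g y) == edge E x y]].

Lemma graph_aut_group_set : group_set graph_aut.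
Proof.
apply/group_setP; split=> [|g h].
  by rewrite inE; apply/forallP=> x; apply/forallP=> y; rewrite !perm1.
rewrite !inE => /'forall_'forall_eqP Hg /'forall_'forall_eqP Hh.
by apply/'forall_'forall_eqP=> x y; rewrite !permM Hh Hg.
Qed.

Definition graph_aut_group : {group {perm T}} := Group graph_aut_group_set.

(* The color i : 'I_lambda stands for the color i.+1 of {1, ..., lambda}. *)
Definition mu_proper (lambda mu : nat) (f : {ffun T -> 'I_lambda}) : bool :=
  [forall v, forall w,
    edge E v w ==> (f v != f w) || ((f v == f w) && (mu < (f v).+1))].

Definition proper_colorings (lambda mu : nat) : {set {ffun T -> 'I_lambda}} :=
  [set f | mu_proper mu f].

Definition chrom (lambda mu : nat) : nat := #|proper_colorings lambda mu|.

Definition color_equiv (G : {group {perm T}}) (lambda : nat) :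
    rel {ffun T -> 'I_lambda} :=
  fun f f' => [exists g in G, f' == [ffun v => f (g v)]].

(* Meaningful when G is a subgroup of graph_aut, so that G preserves properness. *)
Definition orb_chrom (G : {group {perm T}}) (lambda mu : nat) : nat :=
  #|equivalence_partition (color_equiv G (lambda := lambda))
      (proper_colorings lambda mu)|.

End Graphs.

Section Complete.
Variable n : nat.

Definition complete_edge : rel 'I_n := fun x y => x != y.

Lemma complete_edge_sym : symmetric complete_edge.
Proof. by move=> x y; rewrite /complete_edge eq_sym. Qed.

Lemma complete_edge_irrefl : irreflexive complete_edge.
Proof. by move=> x; rewrite /complete_edge eqxx. Qed.

Definition complete_graph : sgraph 'I_n :=
  SGraph complete_edge_sym complete_edge_irrefl.

End Complete.

(* 2-associated Stirling numbers of the first kind; [porbits s] lists all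
   cycles of s, including the trivial cycles at fixed points. *)
Definition assoc_stirling1 (m k : nat) : nat :=
  #|[set s : 'S_m | (#|porbits s| == k)
                    && [forall C in porbits s, 2 <= #|C|]]|.

Definition Qpoly (m : nat) : {poly int} :=
  (\sum_(0 <= k < m.+1) (assoc_stirling1 m k)%:Z *: 'X^k)%R.

(* Main.v *)
(* By Burnside's lemma, n! times the number of orbits is the number of pairs
   (g, f) with g a permutation and f a proper coloring such that f o g = f.
   Let M be the set of points moved by g. Then f is constant on the cycles of
   g, so a point of M shares its color with another point: on M, f only uses
   colors above mu, one for each cycle; on the complement, f is an arbitrary
   proper coloring of a smaller complete graph.  Summing over g with M fixed
   gives Q_m(lambda - mu) P_(n-m)(lambda, mu).  The formula for P follows in
   the same way by splitting the vertices according to the size of the color. *)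
Require Import Defs.
From HB Require Import structures.
From mathcomp Require Import all_boot all_order all_fingroup all_algebra.
Set Implicit Arguments.
Unset Strict Implicit.
Unset Printing Implicit Defensive.
Import GRing.Theory.
Local Open Scope ring_scope.

(** * Sums over subsets, and splitting a set into a subset and its complement *)

Lemma sum_subsets_by_card (n : nat) (F : nat -> nat) :
  (\sum_(M : {set 'I_n}) F #|M| = \sum_(0 <= m < n.+1) 'C(n, m) * F m)%N.
Proof.
have leM (M : {set 'I_n}) : (#|M| < n.+1)%N.
  by rewrite ltnS -[X in (_ <= X)%N]card_ord max_card.
rewrite big_mkord (partition_big (fun M => Ordinal (leM M)) xpredT) //=.
apply: eq_bigr => m _; under eq_bigr => M /eqP/(congr1 val) /= -> do [].
rewrite sum_nat_const; congr (_ * _)%N.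
rewrite -[n in 'C(n, _)]card_ord -card_draws.
by apply: eq_card => M; rewrite !inE.
Qed.

Section Split.
Variables (A B T : finType) (e : A + B -> T) (d : T -> A + B).
Hypotheses (eK : cancel e d) (dK : cancel d e).

(** Restricting along [e] to the two summands is a bijection onto pairs of functions, with gluing
    along [d] as inverse. It factors a count once the condition on colorings separates over a subset
    and its complement. *)
Lemma card_ffun_split (C : finType) (P : pred {ffun A -> C})
    (Q : pred {ffun B -> C}) :
  #|[set f : {ffun T -> C} | P [ffun a => f (e (inl a))]
                           & Q [ffun b => f (e (inr b))]]|
  = (#|[set f | P f]| * #|[set f | Q f]|)%N.
Proof.
rewrite -cardsX.
pose phi (f : {ffun T -> C}) :=
  ([ffun a => f (e (inl a))], [ffun b => f (e (inr b))]).
pose psi (u : {ffun A -> C} * {ffun B -> C}) : {ffun T -> C} :=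
  [ffun x => match d x with inl a => u.1 a | inr b => u.2 b end].
have psiK : cancel psi phi.
  by case=> h p; congr pair; apply/ffunP=> x; rewrite !ffunE eK.
have phiK : cancel phi psi.
  move=> f; apply/ffunP=> x; rewrite ffunE -[in RHS](dK x).
  by case: (d x) => y; rewrite ffunE.
rewrite -(card_imset _ (can_inj psiK)); apply: eq_card => f.
rewrite inE; apply/idP/imsetP => [Pf | [u]].
  by exists (phi f); rewrite ?phiK // !inE.
rewrite !inE => Pu ->; have := psiK u; rewrite /phi.
by case: u Pu => h p /= Pu [-> ->].
Qed.

Definition perm_ext_fun (s : {perm A}) (x : T) : T :=
  e (match d x with inl a => inl (s a) | inr b => inr b end).

Lemma perm_ext_subproof s : injective (perm_ext_fun s).
Proof.
move=> x y /(can_inj eK) eqxy; apply: (can_inj dK).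
by case: (d x) (d y) eqxy => [a|b] [a'|b'] // [/perm_inj->].
Qed.

Definition perm_ext s : {perm T} := perm (@perm_ext_subproof s).

Lemma perm_ext_inl s a : perm_ext s (e (inl a)) = e (inl (s a)).
Proof. by rewrite permE /perm_ext_fun eK. Qed.

Lemma perm_ext_inr s b : perm_ext s (e (inr b)) = e (inr b).
Proof. by rewrite permE /perm_ext_fun eK. Qed.

Lemma perm_ext_inj : injective perm_ext.
Proof.
move=> s t eq_st; apply/permP=> a.
have := perm_ext_inl s a; rewrite eq_st perm_ext_inl.
by move/(can_inj eK) => [].
Qed.

Variable M : {set T}.
Hypotheses (eM : forall a, e (inl a) \in M) (eCM : forall b, e (inr b) \notin M).

Lemma card_split_inl : #|A| = #|M|.
Proof.
have inj : injective (fun a => e (inl a)) by move=> a b /(can_inj eK) [].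
rewrite -cardsT -(card_imset _ inj); apply: eq_card => x.
apply/imsetP/idP => [[a _ ->] // | Mx].
have := dK x; case: (d x) => [a <- | b xE]; first by exists a.
by rewrite -xE (negbTE (eCM b)) in Mx.
Qed.

Lemma perm_on_ext s : perm_on M (perm_ext s).
Proof.
apply/subsetP=> x; rewrite inE -(dK x); case: (d x) => [a|b]; first by [].
by rewrite perm_ext_inr eqxx.
Qed.

(** Only one inclusion is checked directly: extension is injective, so both sides have [#|A|]
    factorial elements. *)
Lemma perm_ext_image : perm_ext @: [set: {perm A}] = [set g | perm_on M g].
Proof.
apply/eqP; rewrite eqEcard; apply/andP; split.
  by apply/subsetP=> _ /imsetP[s _ ->]; rewrite inE perm_on_ext.
rewrite (card_imset _ perm_ext_inj) cardsT cardsE card_perm.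
rewrite -card_split_inl -[X in (_ <= X)%N]cardsT.
have -> : [set: {perm A}] = [set s | perm_on [set: A] s].
  by apply/setP=> s; rewrite !inE; apply/esym/subsetP=> x; rewrite inE.
by rewrite cardsE card_perm cardsT.
Qed.

Lemma perm_ext_support s :
  ([set x | perm_ext s x != x] == M) = [forall a, s a != a].
Proof.
apply/eqP/forallP=> [sM a | sP].
  have := eM a; rewrite -sM inE perm_ext_inl; apply: contra => /eqP sa.
  by rewrite sa.
apply/setP=> x; rewrite inE -(dK x); case: (d x) => [a|b].
  rewrite eM perm_ext_inl; apply: contra (sP a) => /eqP/(can_inj eK) [saa].
  exact/eqP.
by rewrite perm_ext_inr eqxx (negbTE (eCM b)).
Qed.

(** A permutation with support exactly [M] is the extension of a unique derangement of [A], which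
    serves as a model of [M]. *)
Lemma sum_perm_support (F : {perm T} -> nat) :
  (\sum_(g : {perm T} | [set x | g x != x] == M) F g
   = \sum_(s : {perm A} | [forall a, s a != a]) F (perm_ext s))%N.
Proof.
transitivity (\sum_(g in perm_ext @: [set s : {perm A} | [forall a, s a != a]]) F g)%N.
  apply: eq_bigl => g; apply/idP/imsetP => [gM | [s]]; last first.
    by rewrite inE -perm_ext_support => sM ->.
  have : g \in perm_ext @: [set: {perm A}].
    rewrite perm_ext_image inE; apply/subsetP=> x gx.
    by rewrite -(eqP gM) inE.
  case/imsetP=> s _ gE; exists s => //.
  by rewrite inE -perm_ext_support -gE.
rewrite big_imset /=; first by apply: eq_bigl => s; rewrite inE.
by move=> s t _ _; apply: perm_ext_inj.
Qed.

End Split.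

(** Modelling [M] and its complement by ordinals lets the derangements of ['I_m] and the complete
    graph on [n - m] vertices appear literally in the counts. *)
Lemma subset_split (n m : nat) (M : {set 'I_n}) : #|M| = m ->
  exists (e : 'I_m + 'I_(n - m) -> 'I_n) (d : 'I_n -> 'I_m + 'I_(n - m)),
    [/\ cancel e d, cancel d e, forall a, e (inl a) \in M
      & forall b, e (inr b) \notin M].
Proof.
move=> cM; have cCM : #|~: M| = (n - m)%N.
  by rewrite -cM -setTD cardsDS // cardsT card_ord.
pose e (u : 'I_m + 'I_(n - m)) : 'I_n :=
  match u with
  | inl a => enum_val (cast_ord (esym cM) a)
  | inr b => enum_val (cast_ord (esym cCM) b)
  end.
have eM a : e (inl a) \in M by apply: enum_valP.
have eCM b : e (inr b) \notin M by rewrite -in_setC; apply: enum_valP.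
have e_inj : injective e.
  move=> [a|b] [a'|b'] ee.
  - by move/enum_val_inj/cast_ord_inj: ee => ->.
  - by have := eCM b'; rewrite -ee eM.
  - by have := eCM b; rewrite ee eM.
  - by move/enum_val_inj/cast_ord_inj: ee => ->.
have le_mn : (m <= n)%N by rewrite -cM -[X in (_ <= X)%N]card_ord max_card.
have [d eK dK] : bijective e.
  by apply: inj_card_bij e_inj _; rewrite card_sum !card_ord subnKC.
by exists e, d.
Qed.

(** * Cycles of permutations and the values of the polynomials Q_m *)

(** An [s]-invariant function is constant on cycles, hence amounts to one free choice of a value in
    [D] for each cycle. *)
Lemma card_ffun_perm_invariant (A C : finType) (s : {perm A}) (D : pred C) :
  #|[set h : {ffun A -> C} | [forall a, D (h a)]
                           & [forall a, h (s a) == h a]]|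
  = (#|D| ^ #|porbits s|)%N.
Proof.
pose O : finType := {X | X \in porbits s}.
have porbitO a : porbit s a \in porbits s by apply: imset_f.
pose phi (g : {ffun O -> C}) : {ffun A -> C} :=
  [ffun a => g (Sub (porbit s a) (porbitO a))].
have reprO (X : O) : exists a, porbit s a == val X.
  by case/imsetP: (valP X) => a _ ->; exists a.
pose rep X := xchoose (reprO X).
have repE X : porbit s (rep X) = val X := eqP (xchooseP (reprO X)).
have repK X : Sub (porbit s (rep X)) (porbitO (rep X)) = X.
  by apply: val_inj; apply: repE.
have phi_inj : injective phi.
  move=> g g' /ffunP eq_g; apply/ffunP=> X.
  by have := eq_g (rep X); rewrite !ffunE repK.
have -> : (#|D| ^ #|porbits s| = #|[set g : {ffun O -> C} | g \in ffun_on D]|)%N.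
  by rewrite cardsE card_ffun_on card_sig.
rewrite -(card_imset _ phi_inj); apply: eq_card => h.
rewrite inE; apply/andP/imsetP => [[/forallP Dh /forallP sh] | [g]].
  exists [ffun X => h (rep X)].
    by rewrite inE; apply/ffun_onP=> X; rewrite ffunE; apply: Dh.
  apply/ffunP=> a; rewrite !ffunE.
  (* The representative of the cycle of [a] is some power of [s] applied to [a]; invariance carries
     the value of [h] along that power. *)
  set X := Sub _ _; have : rep X \in porbit s a.
    by rewrite -eq_porbit_mem repE.
  case/porbitP=> i ->; elim: i => [|i IHi]; first by rewrite expg0 perm1.
  by rewrite expgSr permM (eqP (sh _)).
rewrite inE => /ffun_onP Dg ->; split; apply/forallP=> a; rewrite !ffunE.
  exact: Dg.
apply/eqP; congr (g _); apply: val_inj => /=.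
exact: (porbit_perm s 1 a).
Qed.

(** A cycle has length one exactly when its element is a fixed point, so the 2-associated Stirling
    numbers count derangements by number of cycles. *)
Lemma derangement_porbits (A : finType) (s : {perm A}) :
  [forall C in porbits s, (2 <= #|C|)%N] = [forall a, s a != a].
Proof.
have fixE a : (2 <= #|porbit s a|)%N = (s a != a).
  apply/card_gt1P/idP => [[x [y [ax ay]]] | saa]; last first.
    by exists (s a), a; rewrite (mem_porbit s 1) porbit_id.
  apply: contra => /eqP saa.
  have fixX i : (s ^+ i)%g a = a.
    by elim: i => [|i IHi]; rewrite ?expg0 ?perm1 // expgSr permM IHi.
  by case/porbitP: ax ay => i -> /porbitP[j ->]; rewrite !fixX.
apply/forall_inP/forallP => [sP a | sP _ /imsetP[a _ ->]].
  by rewrite -fixE sP // imset_f.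
by rewrite fixE.
Qed.

(** Grouping derangements by their number of cycles collects the sum into the coefficients of
    [Qpoly m]. *)
Lemma horner_Qpoly (m q : nat) :
  (Qpoly m).[q%:Z]
  = (\sum_(s : 'S_m | [forall a, s a != a]) q ^ #|porbits s|)%N%:Z.
Proof.
have leO (s : 'S_m) : (#|porbits s| < m.+1)%N.
  by rewrite ltnS -[X in (_ <= X)%N]card_ord leq_imset_card.
rewrite (partition_big (fun s => Ordinal (leO s)) xpredT) //=.
rewrite /Qpoly horner_sum big_mkord -[RHS]natz natr_sum; apply: eq_bigr => k _.
under eq_bigr => s /andP[_ /eqP/(congr1 val) /= ->] do [].
rewrite hornerZ hornerXn sum_nat_const natrM natrX !natz; congr (_ * _)%R.
rewrite /assoc_stirling1; congr Posz; apply: eq_card => s.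
by rewrite inE derangement_porbits andbC.
Qed.

(** * Proper colorings of complete graphs and those fixed by a permutation *)

Section Coloring.
Variables lambda mu : nat.

(** Since [c : 'I_lambda] stands for the color [c.+1], a color above [mu] is one with [mu <= c]. *)
Lemma complete_proper n (f : {ffun 'I_n -> 'I_lambda}) :
  reflect (forall v w, v != w -> f v = f w -> (mu <= f v)%N)
          (mu_proper (complete_graph n) mu f).
Proof.
apply: (iffP forallP) => [fP v w vw fvw | fP v].
  by have /forallP/(_ w)/implyP/(_ vw) := fP v; rewrite fvw eqxx.
apply/forallP=> w; apply/implyP=> vw; case: eqP => //= fvw.
by rewrite ltnS (fP v w).
Qed.

Hypothesis mu_le : (mu <= lambda)%N.

Lemma card_small_colors : #|[pred c : 'I_lambda | (c < mu)%N]| = mu.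
Proof.
rewrite -[RHS](_ : #|[set widen_ord mu_le i | i : 'I_mu]| = mu); last first.
  by rewrite card_imset ?card_ord // => i j /(congr1 val) ij; apply: val_inj.
apply: eq_card => c; rewrite inE /=; apply/idP/imsetP => [cmu | [i _ ->] /=].
  by exists (Ordinal cmu) => //; apply: val_inj.
exact: ltn_ord.
Qed.

Lemma card_large_colors : #|[pred c : 'I_lambda | (mu <= c)%N]| = (lambda - mu)%N.
Proof.
rewrite -[in RHS](card_ord lambda) -(cardC [pred c : 'I_lambda | (c < mu)%N]).
rewrite card_small_colors addKn.
by apply: eq_card => c; rewrite !inE /= -leqNgt.
Qed.

(** Fix the set [M] of vertices with large color. On [M] any large colors are allowed; off [M] the
    small colors must be pairwise distinct, which gives the falling factorial. *)
Lemma chrom_complete r :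
  chrom (complete_graph r) lambda mu
  = (\sum_(0 <= k < r.+1) 'C(r, k) * ((lambda - mu) ^ k * mu ^_ (r - k)))%N.
Proof.
pose large (f : {ffun 'I_r -> 'I_lambda}) := [set v | (mu <= f v)%N].
rewrite -(sum_subsets_by_card r (fun k => (lambda - mu) ^ k * mu ^_ (r - k))%N).
rewrite /chrom -sum1_card (partition_big large xpredT) //=.
apply: eq_bigr => M _; rewrite sum1_card.
have [e [d [eK dK eM eCM]]] := subset_split (erefl #|M|).
pose P (h : {ffun 'I_#|M| -> 'I_lambda}) := [forall a, (mu <= h a)%N].
pose Q (p : {ffun 'I_(r - #|M|) -> 'I_lambda}) :=
  (p \in ffun_on [pred c : 'I_lambda | (c < mu)%N]) && injectiveb p.
have cP : #|[set h | P h]| = ((lambda - mu) ^ #|M|)%N.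
  rewrite -card_large_colors -[X in (_ ^ X)%N]card_ord -card_ffun_on.
  apply: eq_card => h; rewrite inE.
  by apply/forallP/ffun_onP => hP a; have := hP a.
have cQ : #|[set p | Q p]| = (mu ^_ (r - #|M|))%N.
  rewrite -[in RHS]card_small_colors -[X in (_ ^_ X)%N]card_ord -card_inj_ffuns_on.
  by apply: eq_card => p; rewrite !inE.
rewrite -cP -cQ -(card_ffun_split eK dK); apply: eq_card => f.
rewrite [in RHS]inE -topredE /= inE; apply/andP/andP.
  move=> [/complete_proper fP /eqP fM].
  have inM x : (x \in M) = (mu <= f x)%N by rewrite -fM inE.
  split; first by apply/forallP=> a; rewrite ffunE -inM eM.
  have fs b : (f (e (inr b)) < mu)%N.
    by rewrite ltnNge -inM eCM.
  apply/andP; split; first by apply/ffun_onP=> b; rewrite ffunE inE.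
  apply/injectiveP=> b b'; rewrite !ffunE => fbb'.
  apply/eqP; apply/negPn/negP => neq.
  have /fP/(_ fbb') : e (inr b) != e (inr b').
    by apply: contra neq => /eqP/(can_inj eK) [->].
  by rewrite leqNgt fs.
move=> [/forallP hP /andP[/ffun_onP ps /injectiveP pinj]].
have fl a : (mu <= f (e (inl a)))%N by have := hP a; rewrite ffunE.
have fs b : (f (e (inr b)) < mu)%N by have := ps b; rewrite ffunE inE.
split.
  apply/complete_proper=> v w; rewrite -(dK v) -(dK w).
  (* If either vertex lies in [M], the common color is large; two vertices off [M] with equal small
     colors coincide by injectivity. *)
  case: (d v) (d w) => [a|b] [a'|b'] vw fvw //; first by rewrite fvw.
  by case/eqP: vw; congr (e (inr _)); apply: pinj; rewrite !ffunE.
apply/eqP/setP=> v; rewrite inE -(dK v); case: (d v) => [a|b].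
  by rewrite fl eM.
by rewrite (negbTE (eCM b)) leqNgt fs.
Qed.

(** The moved points contribute one large color per cycle of [s], and the fixed points an arbitrary
    proper coloring of the smaller complete graph; no edge between the two sides adds a
    constraint. *)
Lemma card_fixed_proper n m (e : 'I_m + 'I_(n - m) -> 'I_n) d
    (eK : cancel e d) (dK : cancel d e) (s : 'S_m) :
  [forall a, s a != a] ->
  #|[set f in proper_colorings (complete_graph n) lambda mu
       | [forall x, f (perm_ext eK dK s x) == f x]]|
  = ((lambda - mu) ^ #|porbits s| * chrom (complete_graph (n - m)) lambda mu)%N.
Proof.
move=> /forallP sP.
rewrite -card_large_colors -card_ffun_perm_invariant -(card_ffun_split eK dK).
apply: eq_card => f; rewrite !inE; apply/andP/andP.
  move=> [/complete_proper fP /forallP fs].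
  have fsE a : f (e (inl (s a))) = f (e (inl a)).
    by rewrite -(eqP (fs (e (inl a)))) perm_ext_inl.
  split; last first.
    apply/complete_proper=> v w vw; rewrite !ffunE; apply: fP.
    by apply: contra vw => /eqP/(can_inj eK) [->].
  apply/andP; split; apply/forallP=> a; rewrite !ffunE ?fsE //=.
  (* As [s] moves [a], the vertices of [s a] and [a] are adjacent and share a color, so properness
     forces that color to be large. *)
  rewrite -fsE; apply: (fP _ (e (inl a))) => //.
  by apply: contra (sP a) => /eqP/(can_inj eK) [saa]; apply/eqP.
move=> [/andP[/forallP hl /forallP hs] /complete_proper pP].
have fl a : (mu <= f (e (inl a)))%N by have := hl a; rewrite ffunE.
split.
  apply/complete_proper=> v w; rewrite -(dK v) -(dK w).
  case: (d v) (d w) => [a|b] [a'|b'] vw fvw //; first by rewrite fvw.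
  have := pP b b'; rewrite !ffunE; apply => //.
  by apply: contra vw => /eqP ->.
apply/forallP=> x; rewrite -(dK x); case: (d x) => [a|b].
  by have := hs a; rewrite !ffunE perm_ext_inl.
by rewrite perm_ext_inr.
Qed.

(** Permutations are grouped by their support [M]; the inner sum depends only on [#|M|]. *)
Lemma sum_card_fixed_proper n :
  (\sum_(g : 'S_n) #|[set f in proper_colorings (complete_graph n) lambda mu
                        | [forall x, f (g x) == f x]]|
   = \sum_(0 <= m < n.+1)
       'C(n, m) * ((\sum_(s : 'S_m | [forall a, s a != a])
                      (lambda - mu) ^ #|porbits s|)
                   * chrom (complete_graph (n - m)) lambda mu))%N.
Proof.
rewrite -(sum_subsets_by_card n (fun m =>
  (\sum_(s : 'S_m | [forall a, s a != a]) (lambda - mu) ^ #|porbits s|)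
    * chrom (complete_graph (n - m)) lambda mu)%N).
rewrite (partition_big (fun g : 'S_n => [set x | g x != x]) xpredT) //=.
apply: eq_bigr => M _.
have [e [d [eK dK eM eCM]]] := subset_split (erefl #|M|).
rewrite (sum_perm_support eK dK eM eCM) big_distrl /=.
by apply: eq_bigr => s sP; rewrite card_fixed_proper.
Qed.

End Coloring.

(** * Orbit counting for the action on colorings, and the final formula *)

Section ColoringAction.
Variables (T C : finType).

(* The inverse turns precomposition into a right action. *)
Definition precomp (f : {ffun T -> C}) (g : {perm T}) : {ffun T -> C} :=
  [ffun x => f (g^-1%g x)].

Lemma precomp_is_action : is_action [set: {perm T}] precomp.
Proof.
apply: is_total_action => [f | f g h]; apply/ffunP=> x; rewrite !ffunE.
  by rewrite invg1 perm1.
by rewrite invMg permM.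
Qed.

Definition precomp_action := Action precomp_is_action.

End ColoringAction.

Lemma graph_aut_complete n : graph_aut (complete_graph n) = [set: 'S_n].
Proof.
apply/setP=> g; rewrite !inE; apply/'forall_'forall_eqP=> x y.
by rewrite /= /complete_edge (inj_eq perm_inj).
Qed.

(** This is Burnside's lemma in the form [Frobenius_Cauchy], once the equivalence classes are
    recognized as orbits of the whole symmetric group. *)
Lemma orb_chrom_burnside n lambda mu :
  (orb_chrom (complete_graph n) (graph_aut_group (complete_graph n)) lambda mu
     * n`!
   = \sum_(g : 'S_n) #|[set f in proper_colorings (complete_graph n) lambda mu
                          | [forall x, f (g x) == f x]]|)%N.
Proof.
set S := proper_colorings _ _ _.
pose to := precomp_action 'I_n 'I_lambda.
have precompS (f : {ffun 'I_n -> 'I_lambda}) g : (precomp f g \in S) = (f \in S).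
  rewrite !inE; apply/complete_proper/complete_proper => fP v w vw.
    by have := fP (g v) (g w); rewrite !ffunE !permK (inj_eq perm_inj); apply.
  by rewrite !ffunE; apply: fP; rewrite (inj_eq perm_inj).
have actsS : [acts [set: 'S_n], on S | to].
  by apply/actsP=> g _ f; apply: precompS.
have := Frobenius_Cauchy actsS.
have -> : #|[set: 'S_n]| = n`!.
  rewrite -[in RHS](card_ord n) -[#|'I_n|]cardsT -card_perm; apply: eq_card => s.
  by rewrite inE; apply/esym/subsetP=> x; rewrite inE.
have -> : orbit to [set: 'S_n] @: S =
    equivalence_partition
      (color_equiv (graph_aut_group (complete_graph n)) (lambda := lambda)) S.
  apply: eq_in_imset => f fS; apply/setP=> f'; rewrite inE.
  apply/imsetP/andP => [[g _ ->] | [f'S /exists_inP[g _ /eqP ->]]].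
    split; first by rewrite precompS.
    (* The action precomposes with the inverse and [color_equiv] with the element itself, so
       witnesses are exchanged by inversion. *)
    apply/exists_inP; exists g^-1%g; first by rewrite /= graph_aut_complete inE.
    exact/eqP.
  by exists g^-1%g; rewrite ?inE //; apply/ffunP=> x; rewrite !ffunE invgK.
rewrite /orb_chrom => <-.
apply: eq_big => [g|g _]; first by rewrite inE.
apply: eq_card => f; rewrite [in RHS]inE in_setI; congr (_ && _).
(* Being fixed by precomposition with the inverse of [g] or with [g] is the same condition, by
   evaluating at [g x] or at the preimage of [x]. *)
apply/afix1P/forallP => [/ffunP fg x | fg].
  by have := fg (g x); rewrite ffunE permK => ->.
apply/ffunP=> x; rewrite ffunE.
by have := fg (g^-1%g x); rewrite permKV => /eqP ->.
Qed.

Theorem theorem6 (n lambda mu : nat) (n_gt0 : (0 < n)%N)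
    (lambda_gt0 : (0 < lambda)%N) (mu_le : (mu <= lambda)%N) :
  (orb_chrom (complete_graph n) (graph_aut_group (complete_graph n))
     lambda mu)%:R
    = (1 / (n`!)%:R) *
      (\sum_(0 <= m < n.+1)
         ('C(n, m))%:R * ((Qpoly m).[(lambda - mu)%N%:Z])%:~R
         * (chrom (complete_graph (n - m)%N) lambda mu)%:R) :> rat
  /\
  (forall m : nat, (m <= n)%N ->
     chrom (complete_graph (n - m)%N) lambda mu
     = (\sum_(0 <= k < (n - m).+1)
          'C(n - m, k) * (lambda - mu) ^ k * mu ^_ (n - m - k))%N).
Proof.
split=> [|m _]; last first.
  by rewrite chrom_complete //; apply: eq_bigr => k _; rewrite mulnA.
have fact_neq0 : (n`!)%:R != 0 :> rat.
  by rewrite Num.Theory.pnatr_eq0 -lt0n fact_gt0.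
(* Multiplying by [n] factorial clears the denominator, leaving an identity between casts of natural
   numbers and integers. *)
apply: (mulIf fact_neq0); rewrite -natrM orb_chrom_burnside.
rewrite sum_card_fixed_proper // mul1r mulrAC mulVf // mul1r natr_sum.
apply: eq_bigr => m _.
by rewrite horner_Qpoly !natrM mulrA.
Qed.
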